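(* Let $c\in\mathbb{R}$ be a constant and let $f_1,f_2$ be smooth functions of one variable with $1-f_1'(z_1)f_2'(z_2)\ne0$ on a domain $D\subset\mathbb{R}^2$. If $$\zeta(z_1,z_2)=-\frac{2c\,\big(f_1'(z_1)+f_2'(z_2)\big)}{1-f_1'(z_1)f_2'(z_2)}\qquad\text{on } D,$$ then $\zeta$ is a solution to the PDE $$(\zeta^2+4c^2)\,\zeta_{11}-2\,\zeta\,\zeta_{10}\,\zeta_{01}=0 .$$
   Context: Jet notation for partial derivatives: $\zeta_{10}=\partial_{z_1}\zeta$, $\zeta_{01}=\partial_{z_2}\zeta$, $\zeta_{11}=\partial_{z_1}\partial_{z_2}\zeta$. *)

(* Defs.v *)
From Stdlib Require Import Reals.
From Coquelicot Require Import Coquelicot.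

Local Open Scope R_scope.

Definition connected_set {T : UniformSpace} (A : T -> Prop) : Prop :=
  forall U V : T -> Prop, open U -> open V ->
    (forall x, A x -> U x \/ V x) ->
    (exists x, A x /\ U x) ->
    (exists x, A x /\ V x) ->
    exists x, A x /\ U x /\ V x.

Definition is_domain (D : R * R -> Prop) : Prop :=
  (exists p, D p) /\ open D /\ connected_set D.

(* Meant for open I, where it is C^infinity on I. *)
Definition smooth_on (I : R -> Prop) (f : R -> R) : Prop :=
  forall x, I x -> forall n : nat, ex_derive_n f n x.

(* Open intervals when D is a domain: a function of z1 alone (resp. z2 alone)
   is only required to be smooth there. *)
Definition proj1_set (D : R * R -> Prop) : R -> Prop :=
  fun z1 => exists z2, D (z1, z2).

Definition proj2_set (D : R * R -> Prop) : R -> Prop :=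
  fun z2 => exists z1, D (z1, z2).

(* [ex_diff_n u n] asks that all iterated partial derivatives of u of order at
   most n, in every order of differentiation, exist and are continuous. *)
Definition smooth2_on (D : R * R -> Prop) (u : R -> R -> R) : Prop :=
  forall z1 z2, D (z1, z2) -> forall n : nat, ex_diff_n u n z1 z2.

(* [partial_derive i j u] is the jet coordinate u_{ij}: i derivatives in the
   first variable of j derivatives in the second.  [Derive] is total, so
   smoothness is part of being a solution. *)
Definition is_solution (c : R) (D : R * R -> Prop) (u : R -> R -> R) : Prop :=
  smooth2_on D u /\
  forall z1 z2, D (z1, z2) ->
    ((u z1 z2) ^ 2 + 4 * c ^ 2) * partial_derive 1 1 u z1 z2
    - 2 * u z1 z2 * partial_derive 1 0 u z1 z2 * partial_derive 0 1 u z1 z2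
    = 0.

(* Main.v *)
Require Import Defs.
From Stdlib Require Import Reals.
From Coquelicot Require Import Coquelicot.

Local Open Scope R_scope.

(** Smoothness: the functions obtained from constants and the derivatives of
    [f1(z1)] and [f2(z2)] by sums, products and inverses of functions without
    zeros on [D] are continuous on [D] and form a class that is stable, on [D],
    under both partial derivatives; hence all of them are smooth.

    Equation: write [p = f1'(z1)], [q = f2'(z2)] and [s = 1 - p q].  Then
    [zeta_10 = -2c p' (1+q^2)/s^2], [zeta_01 = -2c q' (1+p^2)/s^2] and
    [zeta_11 = -4c p' q' (p+q)/s^3], and the identity
    [(p+q)^2 + s^2 = (1+p^2)(1+q^2)] makes the two terms cancel. *)

Lemma open_locally_2d (D : R * R -> Prop) (x y : R) :
  open D -> D (x, y) -> locally_2d (fun u v => D (u, v)) x y.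
Proof.
  intros hD hxy. apply locally_2d_locally.
  generalize (hD _ hxy). apply filter_imp. now intros [u v].
Qed.

(** Induction on the order, with the function left general so that the hypothesis applies to [u1]
    and [u2]. Since [D] is open, the partial derivatives of [u] agree with these members of [S] on a
    whole neighbourhood, and [ex_diff_n] only depends on such germs. *)
Lemma smooth2_on_of_stable (D : R * R -> Prop) (S : (R -> R -> R) -> Prop) :
  open D ->
  (forall u, S u -> exists u1 u2, S u1 /\ S u2 /\
    forall x y, D (x, y) ->
      continuity_2d_pt u x y /\
      is_derive (fun z => u z y) x (u1 x y) /\
      is_derive (fun z => u x z) y (u2 x y)) ->
  forall u, S u -> smooth2_on D u.
Proof.
  intros hD hS u hu x y hxy n. revert u hu x y hxy.
  induction n as [|n IH]; intros u hu x y hxy;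
    destruct (hS u hu) as (u1 & u2 & hu1 & hu2 & hder);
    destruct (hder x y hxy) as (hc & hx & hy).
  - now split.
  - split; [exact hc|]. split; [now exists (u1 x y)|].
    split; [now exists (u2 x y)|]. split.
    + apply ex_diff_n_ext_loc with u1; [|now apply IH].
      apply locally_2d_impl with (2 := open_locally_2d D x y hD hxy).
      apply locally_2d_forall. intros a b hab.
      symmetry. apply is_derive_unique. now apply hder.
    + apply ex_diff_n_ext_loc with u2; [|now apply IH].
      apply locally_2d_impl with (2 := open_locally_2d D x y hD hxy).
      apply locally_2d_forall. intros a b hab.
      symmetry. apply is_derive_unique. now apply hder.
Qed.

Lemma smooth2_on_ext (D : R * R -> Prop) (u v : R -> R -> R) :
  open D -> (forall x y, D (x, y) -> u x y = v x y) ->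
  smooth2_on D u -> smooth2_on D v.
Proof.
  intros hD heq hu x y hxy n.
  apply ex_diff_n_ext_loc with u; [|now apply hu].
  apply locally_2d_impl with (2 := open_locally_2d D x y hD hxy).
  now apply locally_2d_forall.
Qed.

(** By definition, existence of the derivative of order [S k] is differentiability of
    [Derive_n f k]. *)
Lemma is_derive_Derive_n (I : R -> Prop) (f : R -> R) (k : nat) (x : R) :
  smooth_on I f -> I x -> is_derive (Derive_n f k) x (Derive_n f (S k) x).
Proof.
  intros hf hx. apply Derive_correct. exact (hf x hx (S k)).
Qed.

Lemma continuity_pt_Derive_n (I : R -> Prop) (f : R -> R) (k : nat) (x : R) :
  smooth_on I f -> I x -> continuity_pt (Derive_n f k) x.
Proof.
  intros hf hx. apply continuity_pt_filterlim.
  apply (ex_derive_continuous (Derive_n f k) x). exact (hf x hx (S k)).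
Qed.

(** Derivatives of every order are generators, so that differentiation stays inside the class.
    Opposites and differences are expressed through the constant [-1], which saves constructors and
    the corresponding cases. *)
Inductive jet_expr (D : R * R -> Prop) (f1 f2 : R -> R) :
    (R -> R -> R) -> Prop :=
| jet_const (a : R) : jet_expr D f1 f2 (fun _ _ => a)
| jet_fst (k : nat) : jet_expr D f1 f2 (fun x _ => Derive_n f1 k x)
| jet_snd (k : nat) : jet_expr D f1 f2 (fun _ y => Derive_n f2 k y)
| jet_plus u v : jet_expr D f1 f2 u -> jet_expr D f1 f2 v ->
    jet_expr D f1 f2 (fun x y => u x y + v x y)
| jet_mult u v : jet_expr D f1 f2 u -> jet_expr D f1 f2 v ->
    jet_expr D f1 f2 (fun x y => u x y * v x y)
| jet_inv u : jet_expr D f1 f2 u -> (forall x y, D (x, y) -> u x y <> 0) ->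
    jet_expr D f1 f2 (fun x y => / u x y).

Lemma jet_expr_stable (D : R * R -> Prop) (f1 f2 : R -> R)
    (hf1 : smooth_on (proj1_set D) f1) (hf2 : smooth_on (proj2_set D) f2) u :
  jet_expr D f1 f2 u ->
  exists u1 u2, jet_expr D f1 f2 u1 /\ jet_expr D f1 f2 u2 /\
    forall x y, D (x, y) ->
      continuity_2d_pt u x y /\
      is_derive (fun z => u z y) x (u1 x y) /\
      is_derive (fun z => u x z) y (u2 x y).
Proof.
  induction 1 as [a|k|k
    |u v hu (u1 & u2 & hu1 & hu2 & du) hv (v1 & v2 & hv1 & hv2 & dv)
    |u v hu (u1 & u2 & hu1 & hu2 & du) hv (v1 & v2 & hv1 & hv2 & dv)
    |u hu (u1 & u2 & hu1 & hu2 & du) hne].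
  - exists (fun _ _ => 0), (fun _ _ => 0).
    do 2 (split; [constructor|]). intros x y _.
    split; [apply continuity_2d_pt_const|].
    split; apply (is_derive_const (V := R_NormedModule)).
  - exists (fun x _ => Derive_n f1 (S k) x), (fun _ _ => 0).
    do 2 (split; [constructor|]). intros x y hxy.
    assert (hx : proj1_set D x) by (now exists y).
    split.
    { apply (continuity_1d_2d_pt_comp (Derive_n f1 k) (fun u _ => u)).
      - now apply continuity_pt_Derive_n with (proj1_set D).
      - apply continuity_2d_pt_id1. }
    split; [|apply (is_derive_const (V := R_NormedModule))].
    now apply is_derive_Derive_n with (proj1_set D).
  - exists (fun _ _ => 0), (fun _ y => Derive_n f2 (S k) y).
    do 2 (split; [constructor|]). intros x y hxy.
    assert (hy : proj2_set D y) by (now exists x).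
    split.
    { apply (continuity_1d_2d_pt_comp (Derive_n f2 k) (fun _ v => v)).
      - now apply continuity_pt_Derive_n with (proj2_set D).
      - apply continuity_2d_pt_id2. }
    split; [apply (is_derive_const (V := R_NormedModule))|].
    now apply is_derive_Derive_n with (proj2_set D).
  - exists (fun x y => u1 x y + v1 x y), (fun x y => u2 x y + v2 x y).
    do 2 (split; [now constructor|]). intros x y hxy.
    destruct (du x y hxy) as (cu & ux & uy), (dv x y hxy) as (cv & vx & vy).
    split; [now apply continuity_2d_pt_plus|].
    split; now apply (is_derive_plus (V := R_NormedModule)).
  - exists (fun x y => u1 x y * v x y + u x y * v1 x y),
      (fun x y => u2 x y * v x y + u x y * v2 x y).
    do 2 (split; [now repeat constructor|]). intros x y hxy.
    destruct (du x y hxy) as (cu & ux & uy), (dv x y hxy) as (cv & vx & vy).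
    split; [now apply continuity_2d_pt_mult|].
    split; [apply (is_derive_mult (fun z => u z y) (fun z => v z y))
           |apply (is_derive_mult (fun z => u x z) (fun z => v x z))];
      auto using Rmult_comm.
  (* The derivative [- u1 / u^2] of the inverse, spelled with the constructors only; the inverse
     factors reuse the nonvanishing of [u] on [D]. *)
  - exists (fun x y => (-1 * u1 x y) * (/ u x y * / u x y)),
      (fun x y => (-1 * u2 x y) * (/ u x y * / u x y)).
    do 2 (split; [now repeat constructor|]). intros x y hxy.
    destruct (du x y hxy) as (cu & ux & uy).
    pose proof (hne x y hxy) as h0.
    split; [now apply continuity_2d_pt_inv|]. split.
    + replace (_ * _) with (- u1 x y / u x y ^ 2) by (now field).
      now apply (is_derive_inv (fun z => u z y)).
    + replace (_ * _) with (- u2 x y / u x y ^ 2) by (now field).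
      now apply (is_derive_inv (fun z => u x z)).
Qed.

Lemma jet_expr_smooth (D : R * R -> Prop) (f1 f2 : R -> R) (u : R -> R -> R) :
  open D -> smooth_on (proj1_set D) f1 -> smooth_on (proj2_set D) f2 ->
  jet_expr D f1 f2 u -> smooth2_on D u.
Proof.
  intros hD hf1 hf2. apply smooth2_on_of_stable; [exact hD|].
  now apply jet_expr_stable.
Qed.

(** The numerator of the quotient rule collapses: [p' (1 - p q) + (p + q) p' q = p' (1 + q^2)]. *)
Lemma is_derive_quotient_l (c : R) (p : R -> R) (p' q x : R) :
  1 - p x * q <> 0 -> is_derive p x p' ->
  is_derive (fun t => - (2 * c * (p t + q)) / (1 - p t * q)) x
    (- (2 * c) * p' * (1 + q ^ 2) / (1 - p x * q) ^ 2).
Proof.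
  intros hne hp.
  auto_derive.
  - repeat split; [now exists p'|now exists p'|exact hne].
  - replace (Derive (fun x0 => p x0) x) with p'
      by (symmetry; now apply is_derive_unique).
    field. exact hne.
Qed.

(** The quotient is symmetric in [p] and [q], which reduces this to the previous case. *)
Lemma is_derive_quotient_r (c p : R) (q : R -> R) (q' y : R) :
  1 - p * q y <> 0 -> is_derive q y q' ->
  is_derive (fun t => - (2 * c * (p + q t)) / (1 - p * q t)) y
    (- (2 * c) * q' * (1 + p ^ 2) / (1 - p * q y) ^ 2).
Proof.
  intros hne hq.
  rewrite (Rmult_comm p) in hne |- *.
  apply is_derive_ext with (fun t => - (2 * c * (q t + p)) / (1 - q t * p)).
  - intros t. now rewrite (Rplus_comm p), (Rmult_comm p).
  - now apply is_derive_quotient_l.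
Qed.

(** Differentiates the result of [is_derive_quotient_r] in the other variable, giving the mixed
    derivative. After cancelling one factor [1 - p q], the numerator reduces by
    [p (1 - p q) + q (1 + p^2) = p + q]. *)
Lemma is_derive_quotient_rl (c : R) (p : R -> R) (p' q q' x : R) :
  1 - p x * q <> 0 -> is_derive p x p' ->
  is_derive (fun t => - (2 * c) * q' * (1 + p t ^ 2) / (1 - p t * q) ^ 2) x
    (- (4 * c) * p' * q' * (p x + q) / (1 - p x * q) ^ 3).
Proof.
  intros hne hp.
  auto_derive.
  - repeat split; try (now exists p').
    now apply (pow_nonzero _ 2) in hne.
  - replace (Derive (fun x0 => p x0) x) with p'
      by (symmetry; now apply is_derive_unique).
    field. exact hne.
Qed.

Theorem lemma6p1 (c : R) (D : R * R -> Prop) (f1 f2 : R -> R)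
    (zeta : R -> R -> R)
    (hD : is_domain D)
    (hf1 : smooth_on (proj1_set D) f1)
    (hf2 : smooth_on (proj2_set D) f2)
    (hne : forall z1 z2, D (z1, z2) -> 1 - Derive f1 z1 * Derive f2 z2 <> 0)
    (hzeta : forall z1 z2, D (z1, z2) ->
      zeta z1 z2 =
      - (2 * c * (Derive f1 z1 + Derive f2 z2))
      / (1 - Derive f1 z1 * Derive f2 z2)) :
  is_solution c D zeta.
Proof.
  destruct hD as (_ & hD & _).
  assert (d1 : forall x y, D (x, y) ->
    is_derive (Derive f1) x (Derive_n f1 2 x)).
  { intros x y hxy. apply (is_derive_Derive_n (proj1_set D) f1 1); [exact hf1|].
    now exists y. }
  assert (d2 : forall x y, D (x, y) ->
    is_derive (Derive f2) y (Derive_n f2 2 y)).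
  { intros x y hxy. apply (is_derive_Derive_n (proj2_set D) f2 1); [exact hf2|].
    now exists x. }
  split.
  (* The formula for [zeta], rewritten so that it matches the constructors of [jet_expr]
     literally. *)
  - apply smooth2_on_ext with (fun x y =>
      (- (2 * c) * (Derive_n f1 1 x + Derive_n f2 1 y)) *
      / (1 + -1 * (Derive_n f1 1 x * Derive_n f2 1 y))); [exact hD| |].
    + intros x y hxy. rewrite (hzeta x y hxy). simpl.
      change (Derive (fun x => f1 x) x) with (Derive f1 x).
      change (Derive (fun x => f2 x) y) with (Derive f2 y).
      field. now apply hne.
    + apply jet_expr_smooth with f1 f2; [exact hD|exact hf1|exact hf2|].
      apply jet_mult; [now repeat constructor|].
      apply jet_inv; [now repeat constructor|].
      intros x y hxy.
      replace (1 + _) with (1 - Derive_n f1 1 x * Derive_n f2 1 y) by ring.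
      now apply hne.
  - intros x y hxy.
    pose proof (open_locally_2d D x y hD hxy) as hloc.
    assert (e10 : partial_derive 1 0 zeta x y =
      - (2 * c) * Derive_n f1 2 x * (1 + Derive f2 y ^ 2)
      / (1 - Derive f1 x * Derive f2 y) ^ 2).
    { apply is_derive_unique.
      apply is_derive_ext_loc with (fun t =>
        - (2 * c * (Derive f1 t + Derive f2 y))
        / (1 - Derive f1 t * Derive f2 y)).
      - generalize (locally_2d_1d_const_y _ _ _ hloc).
        apply filter_imp. intros t ht. symmetry. now apply hzeta.
      - apply (is_derive_quotient_l c (Derive f1)); [now apply hne|].
        now apply d1 with y. }
    (* Stated for all [t] with [(t, y)] in [D], not just at [x]: [e11] differentiates this formula
       in the first variable and so needs it near [x]. *)
    assert (e01 : forall t, D (t, y) -> partial_derive 0 1 zeta t y =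
      - (2 * c) * Derive_n f2 2 y * (1 + Derive f1 t ^ 2)
      / (1 - Derive f1 t * Derive f2 y) ^ 2).
    { intros t hty. apply is_derive_unique.
      apply is_derive_ext_loc with (fun z =>
        - (2 * c * (Derive f1 t + Derive f2 z))
        / (1 - Derive f1 t * Derive f2 z)).
      - generalize (locally_2d_1d_const_x _ _ _ (open_locally_2d D t y hD hty)).
        apply filter_imp. intros z hz. symmetry. now apply hzeta.
      - apply (is_derive_quotient_r c (Derive f1 t) (Derive f2));
          [now apply hne|].
        now apply d2 with t. }
    assert (e11 : partial_derive 1 1 zeta x y =
      - (4 * c) * Derive_n f1 2 x * Derive_n f2 2 y
      * (Derive f1 x + Derive f2 y) / (1 - Derive f1 x * Derive f2 y) ^ 3).
    { apply is_derive_unique.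
      apply is_derive_ext_loc with (fun t =>
        - (2 * c) * Derive_n f2 2 y * (1 + Derive f1 t ^ 2)
        / (1 - Derive f1 t * Derive f2 y) ^ 2).
      - generalize (locally_2d_1d_const_y _ _ _ hloc).
        apply filter_imp. intros t ht. symmetry. now apply e01.
      - apply (is_derive_quotient_rl c (Derive f1)); [now apply hne|].
        now apply d1 with y. }
    (* With [p], [q], [s] as above, both terms of the equation become [-16 c^3 p' q' (p+q) (1+p^2)
       (1+q^2) / s^5]. *)
    rewrite e10, e11, (e01 x hxy), (hzeta x y hxy).
    field. now apply hne.
Qed.
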